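(* Let $n\ge 2$ be an integer. For all $\rho\in\mathbb{C}$ with $|\rho|$ sufficiently large (i.e. there is $R>0$, possibly depending on $n$, such that for all $\rho\in\mathbb{C}$ with $|\rho|>R$), the matrix $K_n(\rho)$ possesses exactly two extraordinary eigenvalues (counted with multiplicity), that is, eigenvalues $\lambda$ with $|\lambda|>n$; one of them is of type-1 and the other is of type-2.
   Context: For an integer $n\ge 2$ and $\rho\in\mathbb{C}$, $K_n(\rho)=[\rho^{|j-k|}]_{j,k=1}^n$ (with ones on the diagonal, also when $\rho=0$). An eigenvalue $\lambda\in\mathbb{C}$ of $K_n(\rho)$ is called extraordinary if $|\lambda|>n$ and ordinary if $|\lambda|\le n$. A vector $y\in\mathbb{C}^n$ is symmetric if $y_{n+1-j}=y_j$ for all $j$, and skew-symmetric if $y_{n+1-j}=-y_j$ for all $j$. An eigenvalue of $K_n(\rho)$ is of type-1 if it has a nonzero skew-symmetric eigenvector, and of type-2 if it has a nonzero symmetric eigenvector. *)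

(* Defs.v *)
From HB Require Import structures.
From mathcomp Require Export all_boot all_order all_algebra.
From mathcomp Require Export complex.
From mathcomp Require Export reals.

Set Implicit Arguments.
Unset Strict Implicit.
Unset Printing Implicit Defensive.

Import Order.TTheory GRing.Theory Num.Theory.

Local Open Scope ring_scope.
Local Open Scope complex_scope.

(* The exponent is the distance between j and k as natural numbers; since
   0 ^+ 0 = 1, the diagonal consists of ones even when rho = 0. *)
Definition KMS {R : realType} (n : nat) (rho : R[i]) : 'M[R[i]]_n :=
  \matrix_(j, k) rho ^+ `|j - k|%N.

(* rev_ord is the 0-based form of j |-> n + 1 - j. *)
Definition symmetric_vec {R : realType} (n : nat) (y : 'cV[R[i]]_n) : Prop :=
  forall j : 'I_n, y (rev_ord j) 0 = y j 0.

Definition skew_symmetric_vec {R : realType} (n : nat) (y : 'cV[R[i]]_n) :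
    Prop :=
  forall j : 'I_n, y (rev_ord j) 0 = - y j 0.

(* Column eigenvectors; mathcomp's eigenvalue and eigenspace use rows. *)
Definition is_eigenvector {R : realType} (n : nat) (A : 'M[R[i]]_n)
    (z : R[i]) (y : 'cV[R[i]]_n) : Prop :=
  y != 0 /\ A *m y = z *: y.

Definition type1 {R : realType} (n : nat) (rho z : R[i]) : Prop :=
  exists2 y : 'cV[R[i]]_n,
    is_eigenvector (KMS n rho) z y & skew_symmetric_vec y.

Definition type2 {R : realType} (n : nat) (rho z : R[i]) : Prop :=
  exists2 y : 'cV[R[i]]_n,
    is_eigenvector (KMS n rho) z y & symmetric_vec y.

(* s lists the eigenvalues of A, each repeated according to its algebraic
   multiplicity; this determines s up to permutation. *)
Definition eigenvalue_list {R : realType} (n : nat) (A : 'M[R[i]]_n)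
    (s : seq R[i]) : Prop :=
  char_poly A = \prod_(z <- s) ('X - z%:P).

(* Meant for eigenvalues z of KMS n rho. The norm takes values in R[i], where
   the order compares reals as usual, so the negation is |z| <= n. *)
Definition extraordinary {R : realType} (n : nat) (z : R[i]) : bool :=
  n%:R < `|z|.

(* Main.v *)
Require Import Defs.
From mathcomp Require Import ring zify.
Set Implicit Arguments.
Unset Strict Implicit.
Unset Printing Implicit Defensive.

Import Order.TTheory GRing.Theory Num.Theory.
Local Open Scope ring_scope.
Local Open Scope complex_scope.

(** For [1 - rho ^+ 2 != 0] the matrix [KMS n rho] has a tridiagonal inverse
    [L], and as [|rho|] grows [L] tends to [diag(0, -1, ..., -1, 0)]
    ([kms_inv_mul], [kms_inv_near]).  By a Gershgorin estimate
    ([gershgorin_uniform]) every eigenvalue of [L] is then close to [0] or to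
    [-1].  Since [KMS n rho] has the inverse eigenvalues, those close to [0]
    give its extraordinary eigenvalues and those close to [-1] its ordinary
    ones; it remains to see that [L] has one small eigenvalue for each parity
    of eigenvectors.

    Counting is done with traces: if a matrix has all its eigenvalues close to
    [0] or [-1], minus its trace is close to the number of eigenvalues near
    [-1] ([sum_clustered]).  To count for each parity without choosing bases of
    the symmetric and skew-symmetric subspaces, whose dimensions depend on the
    parity of [n], let [J] be the coordinate reversal, which commutes with [L],
    let [P e = (1 + e J) / 2] be the two spectral projectors of [J], [e = 1] or
    [e = -1], and put [B e = L P e - P (- e)].  This matrix acts as [L] on the
    range of [P e] and as [-1] on the other parity, so it does not create
    eigenvalues near [0].  In the limit its trace is [1 - n] for both values
    of [e] ([mxtrace_parity_part]), so exactly one eigenvalue of [B e] is close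
    to [0], and its eigenvector has parity [e] ([parity_part_spectrum]).

    Multiplicities are transferred to [L] by the two identities
    [B e + B (- e) = L - 1] and [B e * B (- e) = - L], which give
    [('X - B e) ('X - B (- e)) = ('X + 1) ('X - L)]: up to copies of [-1], the
    eigenvalues of [L] are those of [B 1] together with those of [B (- 1)]
    ([char_poly_parity]). *)

(** * Characteristic polynomials and eigenvalues *)

Lemma horner_char_poly (F : comNzRingType) (n : nat) (A : 'M[F]_n) (x : F) :
  (char_poly A).[x] = \det (x%:M - A).
Proof.
rewrite -horner_evalE -det_map_mx; congr (\det _).
by apply/matrixP => i j; rewrite !mxE /= horner_evalE hornerD hornerN hornerMn
  hornerX hornerC.
Qed.

Lemma eq_poly_on_units (F : numFieldType) (p q : {poly F}) :
  (forall x, x != 0 -> p.[x] = q.[x]) -> p = q.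
Proof.
move=> pq; apply/eqP; rewrite -subr_eq0; apply/eqP.
pose rs := [seq (k.+1)%:R : F | k <- iota 0 (size (p - q))].
apply: (@roots_geq_poly_eq0 _ _ rs); last by rewrite size_map size_iota.
- apply/allP => _ /mapP[k _ ->].
  by rewrite rootE hornerD hornerN pq ?subrr // pnatr_eq0.
- rewrite map_inj_uniq ?iota_uniq // => j k /eqP.
  by rewrite eqr_nat => /eqP[].
Qed.

(** For [x != 0], [x - B = (- x) (x^-1 - A) B]; taking determinants gives the
    value of the characteristic polynomial of [B] at every such [x]. *)
Lemma eigenvalue_list_inverse (F : numFieldType) (n : nat) (A B : 'M[F]_n)
    (s : seq F) :
  A *m B = 1%:M -> char_poly A = \prod_(x <- s) ('X - x%:P) ->
  0 \notin s /\ char_poly B = \prod_(x <- s) ('X - (x^-1)%:P).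
Proof.
move=> AB1 chA.
have size_s : size s = n.
  have := size_char_poly A; rewrite chA size_prod_XsubC => -[]; exact.
have detAB : \det A * \det B = 1 by rewrite -det_mulmx AB1 det1.
have detA : \det A = \prod_(x <- s) x.
  have := char_poly_det A; rewrite chA coef0_prod_XsubC size_s.
  by move/(congr1 ( *%R ((-1) ^+ n))); rewrite !mulrA -!exprMn mulrNN mulr1 expr1n !mul1r.
have s_n0 : 0 \notin s.
  apply/negP => s0; move: detAB; rewrite detA (big_rem _ s0) /= !mul0r.
  by move/eqP; rewrite eq_sym oner_eq0.
split=> //; apply: eq_poly_on_units => x x0.
rewrite horner_char_poly horner_prod.
have -> : x%:M - B = (- x)%:M *m ((x^-1)%:M - A) *m B.
  rewrite mul_scalar_mx -scalemxAl mulmxBl AB1 mul_scalar_mx.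
  by rewrite scalerBr scalerA mulNr divff // scaleN1r scaleNr opprK addrC scalemx1.
rewrite !det_mulmx det_scalar -horner_char_poly chA horner_prod.
have -> : \det B = \prod_(y <- s) y^-1.
  apply: (@mulfI _ (\det A)).
    apply: contraTneq isT => dA; move: detAB; rewrite dA mul0r => /eqP.
    by rewrite eq_sym oner_eq0.
  rewrite detAB detA -big_split /= big1_seq // => y /andP[_ sy].
  by rewrite divff //; apply: contraNneq s_n0 => <-.
have -> : (- x) ^+ n = \prod_(y <- s) (- x).
  by rewrite big_const_seq count_predT size_s iter_mulr_1.
rewrite -!big_split /=.
apply: eq_big_seq => y sy.
have y0 : y != 0 by apply: contraNneq s_n0 => <-.
rewrite !hornerE; field; exact/andP.
Qed.

Lemma char_poly_eigenvector (F : fieldType) (n : nat) (A : 'M[F]_n) (x : F) :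
  root (char_poly A) x -> exists2 y : 'cV[F]_n, y != 0 & A *m y = x *: y.
Proof.
rewrite rootE horner_char_poly -det_tr => /det0P[v v0 vA].
exists v^T; first by rewrite -trmx0 (inj_eq trmx_inj).
apply/eqP; rewrite -subr_eq0 -opprB oppr_eq0 -mul_scalar_mx -mulmxBl.
by apply/eqP/trmx_inj; rewrite trmx_mul trmxK vA trmx0.
Qed.

(** At a coordinate [i] where [|y i|] is largest, row [i] of [A y = x y] reads
    [(x - d i) y i = \sum_j (A i j - d i [i = j]) y j], and every [|y j|] is at
    most [|y i|]. *)
Lemma gershgorin_uniform (C : numFieldType) (n : nat) (A : 'M[C]_n)
    (d : 'I_n -> C) (delta x : C) (y : 'cV[C]_n) :
  (forall i j, `|A i j - d i *+ (i == j)| <= delta) ->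
  y != 0 -> A *m y = x *: y ->
  exists i, `|x - d i| <= n%:R * delta.
Proof.
move=> Ad y0 Ay.
have [i0 _] : exists i0, y i0 0 != 0.
  apply/existsP; apply: contraNT y0 => /existsPn y0; apply/eqP/colP => i.
  by rewrite mxE; apply/eqP; move: (y0 i); rewrite negbK.
have [||i _ imax] := @real_arg_maxP C _ i0 xpredT (fun i => `|y i 0|).
- by [].
- by move=> ? _; exact: normr_real.
exists i.
have yi : 0 < `|y i 0|.
  rewrite lt_def normr_ge0 andbT; apply: contraNneq y0 => yi0.
  apply/eqP/colP => j; apply/eqP; rewrite mxE -normr_le0 -yi0; exact: imax.
rewrite -(ler_pM2r yi) -normrM.
have -> : (x - d i) * y i 0 = \sum_j (A i j - d i *+ (i == j)) * y j 0.
  under eq_bigr do rewrite mulrBl.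
  rewrite sumrB mulrBl; congr (_ - _).
    by move/matrixP/(_ i 0): Ay; rewrite !mxE.
  rewrite (bigD1 i) //= eqxx mulr1n big1 ?addr0 // => j.
  by rewrite eq_sym => /negPf->; rewrite mul0r.
apply: le_trans (ler_norm_sum _ _ _) _.
rewrite -mulrA mulr_natl -[X in _ *+ X]card_ord -sumr_const.
apply: ler_sum => j _; rewrite normrM; apply: ler_pM => //; exact: imax.
Qed.

(** Each element counted by [predC a] contributes [x + 1], each other one [x],
    so every term of the combined sum is at most [eta]. *)
Lemma sum_clustered (C : numFieldType) (s : seq C) (eta : C) (a : pred C) :
  (forall x, x \in s -> if a x then `|x| <= eta else `|x + 1| <= eta) ->
  `|\sum_(x <- s) x + (count (predC a) s)%:R| <= (size s)%:R * eta.
Proof.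
elim: s => [|x s IHs] near_s; first by rewrite big_nil add0r normr0 mul0r.
have IH : `|\sum_(z <- s) z + (count (predC a) s)%:R| <= (size s)%:R * eta.
  by apply: IHs => z sz; apply: near_s; rewrite inE sz orbT.
rewrite big_cons /= natrD mulrSr mulrDl mul1r.
rewrite addrACA [leRHS]addrC; apply: le_trans (ler_normD _ _) _.
apply: lerD => //; have := near_s x (mem_head _ _).
by case: ifP => /= _; rewrite ?addr0.
Qed.

Lemma splitting_char_poly (C : closedFieldType) (n : nat) (A : 'M[C]_n) :
  exists s, [/\ char_poly A = \prod_(x <- s) ('X - x%:P), size s = n
              & (0 < n)%N -> \sum_(x <- s) x = \tr A].
Proof.
have [s] := closed_field_poly_normal (char_poly A).
rewrite (monicP (char_poly_monic A)) scale1r => chA.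
have size_s : size s = n.
  have := size_char_poly A; rewrite chA size_prod_XsubC => -[]; exact.
exists s; split=> // n_gt0.
apply: oppr_inj; rewrite -char_poly_trace // chA -size_s coefPn_prod_XsubC //.
by rewrite size_s -lt0n.
Qed.

(** * Splitting a matrix along coordinate reversal *)

Definition flip_mx {F : pzRingType} {n : nat} : 'M[F]_n :=
  \matrix_(i, j) (rev_ord i == j)%:R.

Lemma mul_flip_mx (F : pzRingType) (m n : nat) (A : 'M[F]_(m, n)) i k :
  (flip_mx *m A) i k = A (rev_ord i) k.
Proof.
rewrite mxE (bigD1 (rev_ord i)) //= !mxE eqxx mul1r big1 ?addr0 // => j.
by rewrite mxE eq_sym => /negPf->; rewrite mul0r.
Qed.

Lemma mulmx_flip (F : pzRingType) (m n : nat) (A : 'M[F]_(m, n)) i k :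
  (A *m flip_mx) i k = A i (rev_ord k).
Proof.
rewrite mxE (bigD1 (rev_ord k)) //= !mxE rev_ordK eqxx mulr1 big1 ?addr0 //.
move=> j; rewrite mxE -(inj_eq rev_ord_inj) rev_ordK => /negPf.
by rewrite -(inj_eq rev_ord_inj) rev_ordK => ->; rewrite mulr0.
Qed.

Lemma flip_mxK (F : pzRingType) (n : nat) : flip_mx *m flip_mx = 1%:M :> 'M[F]_n.
Proof. by apply/matrixP => i j; rewrite mul_flip_mx !mxE rev_ordK. Qed.

(** For [e = 1] and [e = -1] these are the projectors onto the symmetric and
    the skew-symmetric vectors. *)
Definition parity_proj {F : fieldType} {n : nat} (e : F) : 'M[F]_n :=
  2^-1 *: (1%:M + e *: flip_mx).

(** When [A] commutes with the reversal and [e ^+ 2 = 1], this matrix acts as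
    [A] on the vectors of parity [e] and as [-1] on those of parity [- e].  The
    value [-1] rather than [0] keeps the complementary parity away from the
    small eigenvalues that are counted later. *)
Definition parity_part {F : fieldType} {n : nat} (A : 'M[F]_n) (e : F) :=
  A *m parity_proj e - parity_proj (- e).

Lemma parity_projD (F : numFieldType) (n : nat) (e : F) :
  parity_proj e + parity_proj (- e) = 1%:M :> 'M[F]_n.
Proof.
rewrite -scalerDr scaleNr addrACA subrr addr0 -mulr2n -scaler_nat scalerA.
by rewrite mulVf ?scale1r // pnatr_eq0.
Qed.

Lemma parity_projM (F : numFieldType) (n : nat) (e : F) : e ^+ 2 = 1 ->
  parity_proj e *m parity_proj (- e) = 0 :> 'M[F]_n.
Proof.
move=> e2; rewrite -scalemxAl -scalemxAr mulmxDl mul1mx mulmxDr mulmx1.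
rewrite -scalemxAl -scalemxAr flip_mxK scalerA mulrN -expr2 e2.
by rewrite !scaleNr scale1r subrKA subrr !scaler0.
Qed.

Lemma parity_projK (F : numFieldType) (n : nat) (e : F) : e ^+ 2 = 1 ->
  parity_proj e *m parity_proj e = parity_proj e :> 'M[F]_n.
Proof.
move=> e2; rewrite -[RHS]mulmx1 -(parity_projD n e) mulmxDr parity_projM //.
by rewrite addr0.
Qed.

Lemma parity_proj_comm (F : fieldType) (n : nat) (A : 'M[F]_n) (e : F) :
  flip_mx *m A = A *m flip_mx ->
  parity_proj e *m A = A *m parity_proj e.
Proof.
move=> cA; rewrite -scalemxAl -scalemxAr mulmxDl mulmxDr mul1mx mulmx1.
by rewrite -scalemxAl -scalemxAr cA.
Qed.

Lemma parity_part_sum (F : numFieldType) (n : nat) (A : 'M[F]_n) (e : F) :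
  parity_part A e + parity_part A (- e) = A - 1%:M.
Proof.
rewrite /parity_part opprK addrACA -mulmxDr -opprD parity_projD mulmx1.
by rewrite [parity_proj (- e) + _]addrC parity_projD.
Qed.

Lemma parity_part_mul (F : numFieldType) (n : nat) (A : 'M[F]_n) (e : F) :
  flip_mx *m A = A *m flip_mx -> e ^+ 2 = 1 ->
  parity_part A e *m parity_part A (- e) = - A.
Proof.
move=> cA e2; have e2' : (- e) ^+ 2 = 1 by rewrite sqrrN.
have pq0 : parity_proj (- e) *m parity_proj e = 0 :> 'M[F]_n.
  by have := parity_projM n e2'; rewrite opprK.
rewrite /parity_part opprK mulmxBl !mulmxBr -mulmxA (mulmxA _ A).
rewrite parity_proj_comm // -mulmxA parity_projM // mulmx0 mulmx0 sub0r.
rewrite -mulmxA parity_projK // mulmxA parity_proj_comm // -mulmxA.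
rewrite parity_projK // pq0 subr0 -opprD -mulmxDr.
by rewrite parity_projD mulmx1.
Qed.

(** The left-hand side is the determinant of [('X - B) ('X - B')], where [B] and
    [B'] are the two parity parts; their sum [A - 1] and product [- A] turn it
    into [('X + 1) ('X - A)]. *)
Lemma char_poly_parity (F : numFieldType) (n : nat) (A : 'M[F]_n) (e : F) :
  flip_mx *m A = A *m flip_mx -> e ^+ 2 = 1 ->
  char_poly (parity_part A e) * char_poly (parity_part A (- e)) =
  ('X - (-1)%:P) ^+ n * char_poly A.
Proof.
move=> cA e2; rewrite -det_scalar -!det_mulmx; congr (\det _).
rewrite /char_poly_mx.
have := parity_part_sum A e; have := parity_part_mul cA e2.
set B := parity_part A e; set B' := parity_part A (- e) => BB' BDB'.
have mBB' : map_mx polyC B *m map_mx polyC B' = - map_mx polyC A.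
  by rewrite -map_mxM BB' map_mxN.
have mBDB' : map_mx polyC B + map_mx polyC B' = map_mx polyC A - 1%:M.
  by rewrite -map_mxD BDB' map_mxB map_mx1.
rewrite mulmxBl !mulmxBr mBB' mul_scalar_mx -scalar_mxM.
rewrite mul_mx_scalar !mul_scalar_mx polyCN opprK.
have -> : map_mx polyC B' = map_mx polyC A - 1%:M - map_mx polyC B.
  by rewrite -mBDB' addrAC subrr add0r.
apply/matrixP => i j; rewrite !mxE; case: (i == j); rewrite ?mulr1n ?mulr0n; ring.
Qed.

(** The component of [y] of parity [- e] is multiplied by [-1] and by [x], so it
    vanishes when [x != -1]. *)
Lemma parity_part_eigenvector (F : numFieldType) (n : nat) (A : 'M[F]_n)
    (e x : F) (y : 'cV[F]_n) :
  flip_mx *m A = A *m flip_mx -> e ^+ 2 = 1 -> x != -1 ->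
  parity_part A e *m y = x *: y -> flip_mx *m y = e *: y /\ A *m y = x *: y.
Proof.
move=> cA e2 x1 By; have e2' : (- e) ^+ 2 = 1 by rewrite sqrrN.
have qy : parity_proj (- e) *m y = 0.
  have : parity_proj (- e) *m (parity_part A e *m y) = - (parity_proj (- e) *m y).
    rewrite mulmxA mulmxBr mulmxA parity_proj_comm // -[_ *m _ *m parity_proj e]mulmxA.
    have := parity_projM n e2'; rewrite opprK => ->.
    by rewrite mulmx0 sub0r parity_projK // mulNmx.
  rewrite By -scalemxAr => /eqP; rewrite -subr_eq0 opprK -[X in _ + X]scale1r.
  rewrite -scalerDl scalemx_eq0 addr_eq0 (negPf x1) => /eqP //.
have py : parity_proj e *m y = y.
  by rewrite -[RHS]mul1mx -(parity_projD n e) mulmxDl qy addr0.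
split; last by move: By; rewrite mulmxBl -mulmxA py qy subr0.
move/eqP: qy; rewrite -scalemxAl scalemx_eq0 invr_eq0 pnatr_eq0 /=.
rewrite mulmxDl mul1mx -scalemxAl scaleNr subr_eq0 => /eqP yE.
by rewrite [in RHS]yE scalerA -expr2 e2 scale1r.
Qed.

(** * Matrices close to diag(0, -1, ..., -1, 0) *)

(** The diagonal entries [0, -1, ..., -1, 0]: the dimension is at least [2], so
    [ord0] and [ord_max] are distinct. *)
Definition inv_limit {F : pzRingType} {m : nat} (i : 'I_m.+2) : F :=
  -1 + (i == ord0)%:R + (i == ord_max)%:R.

Lemma sum_inv_limit (F : comPzRingType) (m : nat) :
  \sum_(i < m.+2) inv_limit i = 1 - (m.+1)%:R :> F.
Proof.
rewrite !big_split /= sumr_const card_ord.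
have sum1 (k : 'I_m.+2) : \sum_i (i == k)%:R = 1 :> F.
  by rewrite (bigD1 k) //= eqxx big1 ?addr0 // => i /negPf->.
by rewrite !sum1 mulNrn mulrS; ring.
Qed.

(** In the limit [A = diag(inv_limit)], the entry [(i, i)] of the parity part is
    [(inv_limit i - 1) / 2]; the term in [e] drops out because the only possible
    fixed point of the reversal is an interior index, where [inv_limit i = -1].
    These entries sum to [- m.+1] for either parity. *)
Lemma mxtrace_parity_part (F : numFieldType) (m : nat) (A : 'M[F]_m.+2)
    (e delta : F) :
  (forall i j, `|A i j - inv_limit i *+ (i == j)| <= delta) -> e ^+ 2 = 1 ->
  `|\tr (parity_part A e) + (m.+1)%:R| <= (m.+2)%:R * delta.
Proof.
move=> nearA e2.
have e_norm : `|e| = 1.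
  by apply/eqP; rewrite -(@eqrXn2 _ 2) ?normr_ge0 // -normrX e2 normr1 expr1n.
pose E i j := A i j - inv_limit i *+ (i == j).
have entry i : parity_part A e i i =
    2^-1 * (inv_limit i - 1) + 2^-1 * (E i i + e * E i (rev_ord i)).
  rewrite /parity_part -scalemxAr mulmxDr mulmx1 -scalemxAr.
  move: (mulmx_flip A i i); move: (A *m flip_mx) => AJ AJi.
  rewrite !mxE AJi eqxx mulr1n /E eqxx mulr1n.
  have [ri | ri] := eqVneq i (rev_ord i); last first.
    by rewrite !mulr0n; ring.
  rewrite -ri mulr1n /inv_limit.
  have ri' : (i : nat) = (m.+2 - i.+1)%N by rewrite {1}ri.
  have -> : (i == ord0) = false.
    by apply/negP => /eqP i0; move: ri'; rewrite i0 /=; lia.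
  have -> : (i == ord_max) = false.
    by apply/negP => /eqP i0; move: ri'; rewrite i0 /=; lia.
  by rewrite !addr0 !mulr1n; ring.
rewrite /mxtrace; under eq_bigr do rewrite entry.
rewrite big_split /= -mulr_sumr sumrB sum_inv_limit sumr_const card_ord.
rewrite addrAC.
have -> : 2^-1 * (1 - (m.+1)%:R - (m.+2)%:R) + (m.+1)%:R = 0 :> F.
  by rewrite (mulrS 1 m.+1); field.
rewrite add0r; apply: le_trans (ler_norm_sum _ _ _) _.
rewrite mulr_natl -[X in _ <= _ *+ X]card_ord -sumr_const; apply: ler_sum => i _.
rewrite normrM normfV normr_nat mulrC ler_pdivrMr // mulr_natr mulr2n.
apply: le_trans (ler_normD _ _) _; rewrite normrM e_norm mul1r.
by apply: lerD; apply: nearA.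
Qed.

Lemma natr_dist_lt1 (F : numDomainType) (a b : nat) :
  `|a%:R - b%:R : F| < 1 -> a = b.
Proof.
wlog ab : a b / (a <= b)%N => [wl|].
  case: (leqP a b) => [|/ltnW] ab lt1; first exact: wl.
  by apply/esym/wl; rewrite // distrC.
rewrite distrC -natrB // normr_nat (ltr_nat F _ 1) ltnS leqn0 subn_eq0 => ba.
by apply/eqP; rewrite eqn_leq ab.
Qed.

(** The eigenvalues of the parity part are within [eta = m.+2 * delta] of [0] or
    [-1], and the test [m.+2 * |z| < 1] separates the two groups.  The number
    of those near [-1] differs from [m.+1] by at most [m.+2 * eta] (sum of the
    eigenvalues) plus [eta] (trace), which is less than [1]. *)
Lemma parity_part_spectrum (C : numClosedFieldType) (m : nat) (A : 'M[C]_m.+2)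
    (e delta : C) :
  (forall i j, `|A i j - inv_limit i *+ (i == j)| <= delta) ->
  flip_mx *m A = A *m flip_mx -> e ^+ 2 = 1 ->
  (m.+3)%:R * ((m.+2)%:R * delta) < 2^-1 ->
  exists (s : seq C) (x : C) (y : 'cV[C]_m.+2),
    [/\ char_poly (parity_part A e) = \prod_(z <- s) ('X - z%:P),
        [seq z <- s | (m.+2)%:R * `|z| < 1] = [:: x],
        y != 0, flip_mx *m y = e *: y & A *m y = x *: y].
Proof.
move=> nearA cA e2; set eta := _ * delta => small_eta.
have delta_ge0 : 0 <= delta by apply: le_trans (nearA 0 0).
have eta_ge0 : 0 <= eta by rewrite mulr_ge0.
have half_lt1 : 2^-1 < 1 :> C by rewrite invf_lt1 ?ltr1n.
have [s [chB size_s sum_s]] := splitting_char_poly (parity_part A e).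
pose small z := (m.+2)%:R * `|z : C| < 1.
have small0 z : `|z| <= eta -> small z.
  move=> z_eta; apply: le_lt_trans (lt_trans small_eta half_lt1).
  by apply: ler_pM => //; rewrite ler_nat.
have small1 z : `|z + 1| <= eta -> small z = false.
  move=> z_eta; apply/negP => small_z.
  have : 1 <= `|z + 1| + `|z|.
    by have := ler_normB (z + 1) z; rewrite addrAC subrr add0r normr1.
  move/le_lt_trans => le1; suff: 1 < 1 :> C by rewrite ltxx.
  apply: le1; rewrite [ltRHS]splitr mul1r; apply: ltr_leD.
    apply: le_lt_trans z_eta _; apply: le_lt_trans small_eta.
    by rewrite ler_peMl // ler1n.
  rewrite -(@ler_pM2l _ 2) // divff ?pnatr_eq0 //; apply: le_trans (ltW small_z).
  by rewrite ler_wpM2r // ler_nat.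
have eigP z : z \in s -> z = -1 \/ exists y : 'cV_m.+2,
    [/\ y != 0, flip_mx *m y = e *: y & A *m y = z *: y].
  move=> sz; have [->|z1] := eqVneq z (-1); [by left | right].
  have [|y y0 By] := @char_poly_eigenvector _ _ (parity_part A e) z.
    by rewrite chB root_prod_XsubC.
  by have [] := parity_part_eigenvector cA e2 z1 By; exists y.
have clust z : z \in s -> if small z then `|z| <= eta else `|z + 1| <= eta.
  move=> /eigP[->|[y [y0 _ Ay]]].
    by rewrite small1 ?addNr ?normr0.
  have [k] := gershgorin_uniform nearA y0 Ay; rewrite -/eta /inv_limit.
  have [->|_] := eqVneq k ord0.
    by rewrite addNr add0r mulr0n subr0 => z_eta; rewrite small0.
  have [_|_] := eqVneq k ord_max.
    by rewrite addr0 addNr subr0 => z_eta; rewrite small0.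
  by rewrite !addr0 opprK => z_eta; rewrite small1.
have := sum_clustered clust; rewrite sum_s // size_s => cl.
have countC : count (predC small) s = m.+1.
  apply: (@natr_dist_lt1 C); pose B := parity_part A e.
  have -> : (count (predC small) s)%:R - (m.+1)%:R
      = (\tr B + (count (predC small) s)%:R) - (\tr B + (m.+1)%:R) :> C by ring.
  apply: le_lt_trans (ler_normB _ _) _.
  apply: le_lt_trans (lerD cl (mxtrace_parity_part nearA e2)) _.
  rewrite -/eta -[X in _ + X]mul1r -mulrDl -mulrSr.
  exact: lt_trans small_eta half_lt1.
have : size [seq z <- s | small z] = 1%N.
  rewrite size_filter; have := count_predC small s.
  by rewrite countC size_s -[in RHS]add1n => /addIn.
case def_s: [seq z <- s | small z] => [|x [|]] //= _.
have : x \in [seq z <- s | small z] by rewrite def_s mem_head.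
rewrite mem_filter => /andP[small_x /eigP[x1|[y [y0 Jy Ay]]]].
  by move: small_x; rewrite x1 small1 // addNr normr0.
by exists s, x, y; split.
Qed.

(** * The inverse of the Kac-Murdock-Szego matrix *)

Definition kms_inv {F : fieldType} {m : nat} (rho : F) : 'M[F]_m.+2 :=
  (1 - rho ^+ 2)^-1 *: \matrix_(j, k)
    ((1 + rho ^+ 2 *+ (0 < j < m.+1)%N) *+ (k == j)
      - rho *+ (k == j.+1 :> nat) - rho *+ (j == k.+1 :> nat)).

Lemma kms_inv_flip (F : fieldType) (m : nat) (rho : F) :
  flip_mx *m kms_inv rho = kms_inv rho *m flip_mx :> 'M[F]_m.+2.
Proof.
apply/matrixP => j k; rewrite mul_flip_mx mulmx_flip !mxE.
have lt_j := ltn_ord j; have lt_k := ltn_ord k.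
have -> : (k == rev_ord j) = (rev_ord k == j).
  by apply/eqP/eqP => [->|<-]; rewrite rev_ordK.
have -> : (k == (rev_ord j).+1 :> nat) = (j == (rev_ord k).+1 :> nat).
  by apply/eqP/eqP; rewrite /=; lia.
have -> : (rev_ord j == k.+1 :> nat) = (rev_ord k == j.+1 :> nat).
  by apply/eqP/eqP; rewrite /=; lia.
have -> : (0 < rev_ord j < m.+1)%N = (0 < j < m.+1)%N by rewrite /=; lia.
by rewrite addrAC.
Qed.

Lemma kms_inv_mul (R : realType) (m : nat) (rho : R[i]) :
  1 - rho ^+ 2 != 0 -> kms_inv rho *m KMS m.+2 rho = 1%:M.
Proof.
move=> d0; apply/matrixP => j k; rewrite -scalemxAl mxE.
apply: (canLR (mulKf d0)); rewrite !mxE.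
under eq_bigr do rewrite !mxE.
pose f (l : nat) := rho ^+ ((l - k) + (k - l))%N.
have sum_delta a : \sum_(l < m.+2) f l *+ (l == a :> nat) = f a *+ (a < m.+2)%N.
  rewrite [RHS]mulrb -(@big_ord1_eq _ _ +%R) [RHS]big_mkcond /=.
  by apply: eq_bigr => l _; rewrite mulrb.
(* Row j of the tridiagonal matrix meets only the columns j, j + 1 and j - 1,
   the last two when they exist. *)
have -> : \sum_(l < m.+2)
    ((1 + rho ^+ 2 *+ (0 < j < m.+1)%N) *+ (l == j)
      - rho *+ (l == j.+1 :> nat) - rho *+ (j == l.+1 :> nat))
      * rho ^+ `|l - k|%N
    = (1 + rho ^+ 2 *+ (0 < j < m.+1)%N) * f j
      - rho * (f j.+1 *+ (j.+1 < m.+2)%N) - rho * (f j.-1 *+ (0 < j)%N).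
  have -> : f j.-1 *+ (0 < j)%N = \sum_(l < m.+2) f l *+ (j == l.+1 :> nat).
    case: (posnP j) => [j0|j_gt0].
      by rewrite big1 // => l _; rewrite j0.
    have lt_j := ltn_ord j.
    have lt_j1 : (j.-1 < m.+2)%N by lia.
    have := sum_delta j.-1; rewrite lt_j1 => <-; apply: eq_bigr => l _; congr (_ *+ _).
    by congr nat_of_bool; apply/eqP/eqP; lia.
  rewrite -sum_delta.
  have -> : f j = \sum_(l < m.+2) f l *+ (l == j :> nat).
    by rewrite sum_delta ltn_ord.
  rewrite !mulr_sumr -!sumrB; apply: eq_bigr => l _.
  have -> : `|l - k|%N = ((l - k) + (k - l))%N by lia.
  rewrite -/(f l) -!mulrnAr -[l == j]/(l == j :> nat).
  by case: (l == j :> nat); case: (l == j.+1 :> nat); case: (j == l.+1 :> nat);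
     rewrite ?mulr1n ?mulr0n; ring.
have lt_j := ltn_ord j; have lt_k := ltn_ord k.
rewrite /f -val_eqE /=.
case: (ltngtP j k) => [jk|kj|jk].
- have [d kE] : exists d, (k = j.+1 + d :> nat)%N by exists (k - j.+1)%N; lia.
  have -> : (j.+1 < m.+2)%N = true by lia.
  have -> : (j < m.+1)%N = true by lia.
  have -> : (j - k + (k - j) = d.+1)%N by lia.
  have -> : (j.+1 - k + (k - j.+1) = d)%N by lia.
  case: (posnP j) => [j0|j0] /=; rewrite ?mulr1n ?mulr0n ?exprS.
    ring.
  have -> : (j.-1 - k + (k - j.-1) = d.+2)%N by lia.
  by rewrite !exprS; ring.
- have [d jE] : exists d, (j = k.+1 + d :> nat)%N by exists (j - k.+1)%N; lia.
  have -> : (0 < j)%N = true by lia.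
  have -> : (j - k + (k - j) = d.+1)%N by lia.
  have -> : (j.-1 - k + (k - j.-1) = d)%N by lia.
  have -> : (j.+1 < m.+2)%N = (j < m.+1)%N by [].
  case: (ltnP j m.+1) => jm /=; rewrite ?mulr1n ?mulr0n ?exprS.
    have -> : (j.+1 - k + (k - j.+1) = d.+2)%N by lia.
    by rewrite !exprS; ring.
  ring.
- have -> : (j - k + (k - j) = 0)%N by lia.
  have -> : (j.+1 - k + (k - j.+1) = 1)%N by lia.
  have -> : (j.+1 < m.+2)%N = (j < m.+1)%N by [].
  case: (posnP j) => [j0|j0] /=.
    have -> : (j < m.+1)%N = true by lia.
    by rewrite !mulr1n !mulr0n; ring.
  have -> : (j.-1 - k + (k - j.-1) = 1)%N by lia.
  by case: (ltnP j m.+1) => jm /=; rewrite ?mulr1n ?mulr0n; ring.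
Qed.

(** Up to the factor [(1 - rho ^+ 2)^-1], the entries of the difference are
    [1] at the two corners, [2] elsewhere on the diagonal and [- rho] next to
    it, hence at most [2 |rho|] in absolute value; and
    [|1 - rho ^+ 2| >= |rho| ^+ 2 / 2]. *)
Lemma kms_inv_near (C : numFieldType) (m : nat) (rho : C) : 2 < `|rho| ->
  forall i j : 'I_m.+2,
  `|kms_inv rho i j - inv_limit i *+ (i == j)| <= 4 / `|rho|.
Proof.
move=> rho2; set t := `|rho|.
have t_gt0 : 0 < t by apply: lt_trans rho2.
have d_ge : t ^+ 2 / 2 <= `|1 - rho ^+ 2|.
  have : t ^+ 2 <= 1 + `|1 - rho ^+ 2|.
    by have := ler_normB 1 (1 - rho ^+ 2); rewrite subKr normrX normr1.
  rewrite -lerBlDl; apply: le_trans; rewrite lerBrDl {2}(splitr (t ^+ 2)) lerD2r.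
  rewrite ler_pdivlMr // mul1r; apply: le_trans (_ : t <= _).
    exact: ltW.
  rewrite expr2 ler_peMr ?(ltW t_gt0) // (le_trans _ (ltW rho2)) ?ler1n //.
have t2_gt0 : 0 < t ^+ 2 / 2 by rewrite divr_gt0 ?exprn_gt0.
have d_gt0 : 0 < `|1 - rho ^+ 2| by apply: lt_le_trans d_ge.
have d0 : 1 - rho ^+ 2 != 0 by rewrite -normr_gt0.
have quot c : `|c| <= 2 * t -> `|(1 - rho ^+ 2)^-1 * c| <= 4 / t.
  move=> c_le; rewrite normrM normfV mulrC ler_pdivrMr //.
  apply: le_trans c_le _.
  apply: le_trans (ler_wpM2l _ d_ge); last by rewrite divr_ge0 ?(ltW t_gt0).
  rewrite le_eqVlt; apply/orP; left; apply/eqP; field.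
  by rewrite gt_eqF.
have t1 : 1 <= t by rewrite (le_trans _ (ltW rho2)) ?ler1n.
have t2 : 2 <= 2 * t by rewrite ler_peMr.
have t12 : 1 <= 2 * t by apply: le_trans t2; rewrite ler1n.
have tt : t <= 2 * t by rewrite ler_peMl ?ler1n // ltW.
have quot_diff a c : `|c - (1 - rho ^+ 2) * a| <= 2 * t ->
    `|(1 - rho ^+ 2)^-1 * c - a| <= 4 / t.
  by move/quot; rewrite mulrBr mulKf.
move=> i j; rewrite !mxE /inv_limit eq_sym; apply: quot_diff.
have [ij|ij] := eqVneq i j.
  rewrite ij !(ltn_eqF (ltnSn j)) mulr0n !subr0 !mulr1n.
  rewrite -!val_eqE /=; have lt_j := ltn_ord j.
  case: (posnP j) => [->|j_gt0] /=.
    by rewrite mulr0n !addr0 addNr mulr0 subr0 normr1.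
  case: (ltnP j m.+1) => jm /=.
    rewrite (ltn_eqF jm) mulr1n mulr0n !addr0.
    have -> : 1 + rho ^+ 2 - (1 - rho ^+ 2) * -1 = 2 by ring.
    by rewrite normr_nat.
  have -> : (j == m.+1 :> nat) by rewrite eqn_leq jm -ltnS lt_j.
  by rewrite mulr1n !mulr0n !addr0 addNr mulr0 subr0 normr1.
rewrite mulr0n mulr0n mulr0 subr0 sub0r.
have [ji|_] := eqVneq (j : nat) i.+1.
  rewrite ji (ltn_eqF (leqnSn i.+1)) mulr1n mulr0n subr0 normrN; exact: tt.
rewrite mulr0n oppr0 sub0r normrN; case: eqP => _; last by rewrite normr0 mulr_ge0 // ltW.
exact: tt.
Qed.

(** * The two extraordinary eigenvalues *)

Unset Implicit Arguments.

Theorem mainTheorem1 (R : realType) (n : nat) (hn : (2 <= n)%N) :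
  exists2 r : R, 0 < r &
    forall rho : R[i], r%:C < `|rho| ->
      exists (s : seq R[i]) (z1 z2 : R[i]),
        [/\ eigenvalue_list (KMS n rho) s,
            perm_eq [seq z <- s | extraordinary n z] [:: z1; z2],
            type1 n rho z1
          & type2 n rho z2].
Proof.
case: n hn => [|[|m]] // _.
(* With entries within 4 / |rho| of the limit, this radius is what makes
   (n + 1) * n * (4 / |rho|) smaller than 1 / 2. *)
exists ((8 * m.+3 * m.+2)%N)%:R; first by rewrite ltr0n; lia.
move=> rho; rewrite rmorph_nat => rho_large.
have rho2 : 2 < `|rho|.
  by apply: le_lt_trans rho_large; rewrite ler_nat; lia.
have rho_gt0 : 0 < `|rho| by apply: lt_trans rho2.
have d0 : 1 - rho ^+ 2 != 0.
  apply: contraTneq rho2 => /eqP; rewrite subr_eq0 => /eqP rho1.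
  have -> : `|rho| = 1.
    by apply/eqP; rewrite -(@eqrXn2 _ 2) ?normr_ge0 // -normrX -rho1 normr1 expr1n.
  by rewrite (ltr_nat _ 2 1).
set L : 'M[R[i]]_m.+2 := kms_inv rho.
have LK : L *m KMS m.+2 rho = 1%:M by exact: kms_inv_mul.
have KL : KMS m.+2 rho *m L = 1%:M by exact: mulmx1C.
have small_delta : (m.+3)%:R * ((m.+2)%:R * (4 / `|rho|)) < 2^-1.
  rewrite !mulrA ltr_pdivrMr // [ltRHS]mulrC ltr_pdivlMr //.
  by apply: le_lt_trans rho_large; rewrite -!natrM ler_nat; lia.
have cL := kms_inv_flip m rho; have nearL := kms_inv_near (m := m) rho2.
have [s1 [x1 [y1 [ch1 sm1 y10 Jy1 Ly1]]]] :=
  parity_part_spectrum nearL cL (etrans (sqrrN 1) (expr1n _ 2)) small_delta.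
have [s2 [x2 [y2 [ch2 sm2 y20 Jy2 Ly2]]]] :=
  parity_part_spectrum nearL cL (expr1n _ 2) small_delta.
have [sL [chL _ _]] := splitting_char_poly L.
pose small (z : R[i]) := (m.+2)%:R * `|z| < 1.
have smallL : perm_eq [seq z <- sL | small z] [:: x1; x2].
  have perm_s : perm_eq (s1 ++ s2) (nseq m.+2 (-1) ++ sL).
    apply: prod_XsubC_eq; rewrite !big_cat big_nseq iter_mulr_1 -ch1 -ch2 -chL /=.
    by rewrite mulrC (char_poly_parity cL (expr1n _ 2)).
  have := perm_filter small perm_s; rewrite !filter_cat sm1 sm2 perm_sym.
  have -> : [seq z <- nseq m.+2 (-1) | small z] = [::]; last by [].
  by rewrite filter_nseq /small normrN1 mulr1 (ltr_nat _ _ 1).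
have [sL0 chK] := eigenvalue_list_inverse LK chL.
exists [seq z^-1 | z <- sL], x1^-1, x2^-1.
have eigK x y : L *m y = x *: y -> x != 0 -> KMS m.+2 rho *m y = x^-1 *: y.
  move=> Ly x0; apply: (scalerI x0); rewrite scalemxAr -Ly mulmxA KL mul1mx.
  by rewrite scalerA divff // scale1r.
have x_neq0 x : x \in [:: x1; x2] -> x != 0.
  rewrite -(perm_mem smallL) mem_filter => /andP[_].
  by apply: contraTneq => ->.
split.
- by rewrite /eigenvalue_list chK big_map.
- rewrite filter_map; apply: perm_trans (perm_map GRing.inv smallL).
  rewrite (@eq_in_filter _ _ small) // => z zL.
  have z0 : 0 < `|z| by rewrite normr_gt0; apply: contraNneq sL0 => <-.
  by rewrite /extraordinary /small /= normfV -[_^-1]mul1r ltr_pdivlMr.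
- exists y1; first by split=> //; apply: eigK; rewrite ?x_neq0 ?mem_head.
  by move=> j; rewrite -mul_flip_mx Jy1 scaleN1r mxE.
- exists y2; first by split=> //; apply: eigK; rewrite ?x_neq0 ?inE ?eqxx ?orbT.
  by move=> j; rewrite -mul_flip_mx Jy2 scale1r.
Qed.
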